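(* Let $(P,g)$ be a Carrollian $\mathbb{R}^\times$-bundle such that the Euler vector field is Killing, i.e. $\mathcal{L}_{\Delta_P}g=0$. Then all vector fields in $\mathrm{Sec}(VP)$ are Killing, i.e. $\mathcal{L}_{X}g=0$ for every vertical vector field $X$ on $P$.
   Context: $\mathbb{R}^\times:=\mathbb{R}\setminus\{0\}$ with multiplication. A principal $\mathbb{R}^\times$-bundle $\pi:P\to M$ is a line bundle over $M$ with its zero section removed, with $\mathbb{R}^\times$ acting by fibrewise multiplication; adapted local coordinates are $(x^a,t)$, with $x^a$ coordinates on $M$ and $t\neq 0$ the fibre coordinate. The Euler vector field $\Delta_P$ is the fundamental vector field of the action, locally $\Delta_P=t\,\partial_t$; every vertical vector field (section of $VP=\ker(d\pi)$) is globally $f\Delta_P$ with $f\in C^\infty(P)$. A Carrollian $\mathbb{R}^\times$-bundle is a pair $(P,g)$, where $P$ is a principal $\mathbb{R}^\times$-bundle and $g$ is a degenerate metric (smooth symmetric covariant 2-tensor) on the total space $P$ with $\ker(g):=\{X\in\mathrm{Vect}(P): g(X,-)=0\}=\mathrm{Sec}(VP)$. A vector field $X$ on $P$ is Killing if $\mathcal{L}_Xg=0$. *)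

(* Defs.v *)
From HB Require Import structures.
From mathcomp Require Import all_boot all_order all_algebra.
From mathcomp Require Import all_classical all_reals all_analysis.

Set Implicit Arguments.
Unset Strict Implicit.
Unset Printing Implicit Defensive.

Import Order.TTheory GRing.Theory Num.Theory.
Import numFieldNormedType.Exports.

Local Open Scope classical_set_scope.
Local Open Scope ring_scope.

(* Vectors are rows, and ['J f y] is the library Jacobian, so that the
   differential of f at y sends v to [v *m 'J f y]. *)

Section SmoothFunctions.
Context {R : realType} {d : nat}.

Definition partial (k : 'I_d) (f : 'rV[R]_d -> R) (y : 'rV[R]_d) : R :=
  derive f y (delta_mx 0 k).

(* Only used for open U, where pointwise continuity and the existence of
   partial derivatives depend on the restriction of f to U alone. *)
Fixpoint Ck_on (k : nat) (U : set 'rV[R]_d) (f : 'rV[R]_d -> R) : Prop :=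
  (forall y, U y -> {for y, continuous f}) /\
  if k is k'.+1 then
    forall i : 'I_d, (forall y, U y -> derivable f y (delta_mx 0 i)) /\
                     Ck_on k' U (partial i f)
  else True.

Definition smooth_on (U : set 'rV[R]_d) (f : 'rV[R]_d -> R) : Prop :=
  forall k, Ck_on k U f.

Definition smooth_map_on (e : nat) (U : set 'rV[R]_d)
    (f : 'rV[R]_d -> 'rV[R]_e) : Prop :=
  forall i : 'I_e, smooth_on U (fun y => f y 0 i).

End SmoothFunctions.

Section Manifolds.
Context {R : realType} {d : nat}.

(* A chart is a homeomorphism between open sets, represented by total functions
   [cmap] and [cinv] whose values off [cdom] and [cmap @` cdom] are
   irrelevant. *)
Record chart (T : topologicalType) := Chart {
  cdom : set T;
  cmap :> T -> 'rV[R]_d;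
  cinv : 'rV[R]_d -> T;
  cdom_open : open cdom;
  cimg_open : open (cmap @` cdom);
  cmapK : forall x, cdom x -> cinv (cmap x) = x;
  cmap_continuous : forall x, cdom x -> {for x, continuous cmap};
  cinv_continuous : forall y, (cmap @` cdom) y -> {for y, continuous cinv}
}.

Definition cimg (T : topologicalType) (phi : chart T) : set 'rV[R]_d :=
  phi @` cdom phi.

Definition transition (T : topologicalType) (phi psi : chart T) :
    'rV[R]_d -> 'rV[R]_d :=
  psi \o cinv phi.

Definition compatible (T : topologicalType) (phi psi : chart T) : Prop :=
  smooth_map_on (phi @` (cdom phi `&` cdom psi)) (transition phi psi) /\
  smooth_map_on (psi @` (cdom phi `&` cdom psi)) (transition psi phi).

End Manifolds.

Arguments chart : clear implicits.

Record manifold (R : realType) (d : nat) := Manifold {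
  mfd_space :> topologicalType;
  atlas : set (chart R d mfd_space);
  mfd_hausdorff : hausdorff_space mfd_space;
  mfd_second_countable : @second_countable mfd_space;
  atlas_cover : forall x : mfd_space, exists2 phi, atlas phi & cdom phi x;
  atlas_compatible :
    forall phi psi, atlas phi -> atlas psi -> compatible phi psi;
  atlas_maximal :
    forall phi, (forall psi, atlas psi -> compatible phi psi) -> atlas phi
}.

(* Tensor fields on the open submanifold W of N are given by their components
   in the charts of W, as functions of the coordinates: in the chart phi the
   vector field is X^k(y) d/dy^k with X^k(y) = [X phi y 0 k], and the tensor is
   g_ij(y) dy^i dy^j with g_ij(y) = [g phi y i j]. *)

Section TensorFields.
Context {R : realType} {d : nat} {N : manifold R d}.
Implicit Types (W : set N) (phi psi : chart R d N).

(* the maximal atlas of the open submanifold W *)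
Definition chart_on W phi : Prop := atlas phi /\ cdom phi `<=` W.

Definition vector_components : Type :=
  chart R d N -> 'rV[R]_d -> 'rV[R]_d.

Definition tensor2_components : Type :=
  chart R d N -> 'rV[R]_d -> 'M[R]_d.

Record vector_field W := VectorField {
  vf_comp :> chart R d N -> 'rV[R]_d -> 'rV[R]_d;
  vf_smooth : forall phi, chart_on W phi ->
    smooth_map_on (cimg phi) (vf_comp phi);
  vf_transform : forall phi psi, chart_on W phi -> chart_on W psi ->
    forall x, cdom phi x -> cdom psi x ->
    vf_comp psi (psi x) =
      vf_comp phi (phi x) *m jacobian (transition phi psi) (phi x)
}.

Record sym_tensor2 W := SymTensor2 {
  st_comp :> chart R d N -> 'rV[R]_d -> 'M[R]_d;
  st_smooth : forall phi, chart_on W phi ->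
    forall i j, smooth_on (cimg phi) (fun y => st_comp phi y i j);
  st_transform : forall phi psi, chart_on W phi -> chart_on W psi ->
    forall x, cdom phi x -> cdom psi x ->
    st_comp phi (phi x) =
      jacobian (transition phi psi) (phi x) *m st_comp psi (psi x)
        *m (jacobian (transition phi psi) (phi x))^T;
  st_symmetric : forall phi, chart_on W phi ->
    forall y, cimg phi y -> (st_comp phi y)^T = st_comp phi y
}.

(* g(X, -) = 0 *)
Definition in_kernel W (g : sym_tensor2 W) (X : vector_field W) : Prop :=
  forall phi, chart_on W phi -> forall y, cimg phi y ->
  X phi y *m g phi y = 0.

(* (L_X g)_ij = X^k d_k g_ij + g_kj d_i X^k + g_ik d_j X^k *)
Definition lie_derivative (X : vector_components) (g : tensor2_components) :
    tensor2_components :=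
  fun phi y => \matrix_(i, j) \sum_(k < d)
    (X phi y 0 k * partial k (fun z => g phi z i j) y
     + g phi y k j * partial i (fun z => X phi z 0 k) y
     + g phi y i k * partial j (fun z => X phi z 0 k) y).

Definition killing W (g : sym_tensor2 W) (X : vector_components) : Prop :=
  forall phi, chart_on W phi -> forall y, cimg phi y ->
  lie_derivative X g phi y = 0.

End TensorFields.

Arguments vector_components {R d} N.
Arguments tensor2_components {R d} N.

Section LineBundles.
Context {R : realType} {n : nat}.

(* The chart phi of the total space has the form (x^a, t), where the x^a are
   the coordinates chi of the base point and t is linear on the fibres;
   equivalently phi = (chi * id) \o Phi for a local trivialization
   Phi : pi^-1(cdom chi) -> cdom chi * R of vector bundles. *)
Definition bundle_chart (M : manifold R n) (L : manifold R (n + 1))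
    (pi : L -> M) (zero : M -> L) (add : L -> L -> L) (scale : R -> L -> L)
    (chi : chart R n M) (phi : chart R (n + 1) L) : Prop :=
  [/\ cdom phi = pi @^-1` cdom chi,
      forall x, cdom phi x -> lsubmx (phi x) = chi (pi x),
      cimg phi = [set y | cimg chi (lsubmx y)] &
      [/\ forall m, cdom chi m -> rsubmx (phi (zero m)) = 0,
          forall x y, cdom phi x -> pi x = pi y ->
            rsubmx (phi (add x y)) = rsubmx (phi x) + rsubmx (phi y) &
          forall s x, cdom phi x ->
            rsubmx (phi (scale s x)) = s *: rsubmx (phi x)]].

(* [lb_add] is only meaningful on pairs of points of the same fibre.  The
   vector space axioms and the one-dimensionality of the fibres follow from
   [lb_trivial], as t is then a linear bijection from each fibre onto R. *)
Record line_bundle (M : manifold R n) := LineBundle {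
  lb_total :> manifold R (n + 1);
  lb_proj : lb_total -> M;
  lb_zero : M -> lb_total;
  lb_add : lb_total -> lb_total -> lb_total;
  lb_scale : R -> lb_total -> lb_total;
  lb_proj_zero : forall m, lb_proj (lb_zero m) = m;
  lb_proj_add : forall x y, lb_proj x = lb_proj y ->
    lb_proj (lb_add x y) = lb_proj x;
  lb_proj_scale : forall s x, lb_proj (lb_scale s x) = lb_proj x;
  lb_trivial : forall m : M, exists chi : chart R n M,
    [/\ atlas chi, cdom chi m &
        exists2 phi : chart R (n + 1) lb_total, atlas phi &
          bundle_chart lb_proj lb_zero lb_add lb_scale chi phi]
}.

Context {M : manifold R n}.

(* The principal R^*-bundle P: the open submanifold of nonzero elements of L,
   on which s <> 0 acts by [lb_scale s]. *)
Definition principal (L : line_bundle M) : set L :=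
  [set x : L | x <> lb_zero L (lb_proj x)].

Arguments principal : clear implicits.

(* The fundamental vector field of the action, i.e. the velocity at s = 0 of
   the curves s |-> exp(s) . x. *)
Definition euler (L : line_bundle M) : vector_components (lb_total L) :=
  fun phi y =>
    derive1 (fun s : R => phi (lb_scale (expR s) (cinv phi y))) 0.

(* d pi (X) = 0 *)
Definition vertical (L : line_bundle M) (X : vector_field (principal L)) :
    Prop :=
  forall (phi : chart R (n + 1) L) (chi : chart R n M),
  chart_on (principal L) phi -> atlas chi ->
  forall x, cdom phi x -> cdom chi (lb_proj x) ->
  X phi (phi x) *m jacobian (chi \o @lb_proj M L \o cinv phi) (phi x) = 0.

Record carrollian_metric (L : line_bundle M) := CarrollianMetric {
  cm_tensor :> sym_tensor2 (principal L);
  cm_kernel : forall X : vector_field (principal L),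
    in_kernel cm_tensor X <-> vertical X
}.

End LineBundles.

Arguments principal {R n M} L _.
Arguments euler {R n M} L _ _.

(* Main.v *)
From HB Require Import structures.
Require Import Defs.
From mathcomp Require Import all_boot all_order all_algebra.
From mathcomp Require Import all_classical all_reals all_analysis.
From mathcomp Require Import ring.

(** If X lies in the kernel of g, then L_(fX) g = f L_X g for every function f:
    the Leibniz rule produces only extra terms df . g(X, -), which vanish
    ([lie_derivative_scale]).  Vertical fields are multiples of the Euler field
    E and span the kernel of g, so L_E g = 0 should propagate to all of them.

    The proof uses this identity backwards.  Fix a vertical X and a point y of a
    chart.  If X(y) <> 0, then near y the Euler field is E = f X with f
    differentiable and f(y) <> 0 ([euler_proportional]), so that
    0 = L_E g(y) = f(y) L_X g(y).  The field that is differentiated is X, which is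
    smooth and in the kernel in every chart by hypothesis, whereas for E both
    would have to be derived from its definition by curves.  If X(y) = 0, then
    L_X g(y) only involves the terms g_kj d_i X^k, and these are the derivatives
    at y of X^k g_kj = 0 ([lie_derivative_eq0]).

    To find f, pass to a chart (x^a, t) adapted to the bundle.  There
    E = (0, t) and X = (0, xi), hence f = t / xi, and t <> 0 because the point
    is not in the zero section.  Both components are then read in the given
    chart: t is a component of the transition map T, and
    xi = X^k d_k T.  So the differentiability of f needs nothing more than that
    of X and of the partial derivatives of T.

    The components of E and X in the given chart follow from those in the
    adapted chart through the Jacobian of the transition map.  Smoothness is
    given by continuous iterated partial derivatives, and the Jacobian by the
    total derivative, hence the need for the theorem that C^1 functions are
    differentiable ([Ck_on_differentiable]). *)

Set Implicit Arguments.
Unset Strict Implicit.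
Unset Printing Implicit Defensive.

Import Order.TTheory GRing.Theory Num.Theory.
Import numFieldNormedType.Exports.

Local Open Scope classical_set_scope.
Local Open Scope ring_scope.

(** * Directional derivatives and differentials *)

Section Differentiability.
Context {R : realType}.

Lemma is_derive_line (V W : normedModType R) (f : V -> W) (x v : V) (t : R) :
  derivable f (t *: v + x) v ->
  is_derive t 1 (fun s : R => f (s *: v + x)) ('D_v f (t *: v + x)).
Proof.
have growthE : (fun h : R => h^-1 *: (((fun s : R => f (s *: v + x)) \o shift t)
      (h *: 1) - f (t *: v + x))) =
    (fun h : R => h^-1 *: ((f \o shift (t *: v + x)) (h *: v) - f (t *: v + x))).
  by apply/funext => h /=; rewrite [_ *: 1]mulr1 scalerDl addrA.
by move=> fd; apply: DeriveDef; [rewrite /derivable growthE|rewrite /derive growthE].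
Qed.

(** The mean value theorem on the segment from x to x + a v; a may be negative,
    which spares the users a case analysis on the sign of an increment. *)
Lemma directional_MVT (V : normedModType R) (f : V -> R) (x v : V) (a : R) :
  (forall s : R, `|s| <= `|a| -> derivable f (s *: v + x) v) ->
  exists2 s : R, `|s| <= `|a| & f (a *: v + x) - f x = 'D_v f (s *: v + x) * a.
Proof.
move=> fd; pose g s := f (s *: v + x).
have dg (s : R) : `|s| <= `|a| -> is_derive s 1 g ('D_v f (s *: v + x)).
  by move=> sa; apply/is_derive_line/fd.
have gc (b c : R) : (forall s, s \in `[b, c] -> `|s| <= `|a|) ->
    {within `[b, c], continuous g}.
  move=> bc; apply: derivable_within_continuous => s /bc/dg dgs.
  exact: ex_derive.
have g0 : g 0 = f x by rewrite /g scale0r add0r.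
have [a0|a0] := leP 0 a.
  have sa (s : R) : s \in `[0, a] -> `|s| <= `|a|.
    by rewrite in_itv /= => /andP[s0 sa]; rewrite !ger0_norm.
  have [s sI] := MVT_segment a0
    (fun s h => dg s (sa s (subset_itv_oo_cc h))) (gc _ _ sa).
  by rewrite g0 subr0 => gE; exists s; [exact: sa|].
have sa (s : R) : s \in `[a, 0] -> `|s| <= `|a|.
  rewrite in_itv /= => /andP[s0 s1].
  by rewrite !ler0_norm ?lerN2// ltW.
have [s sI] := MVT_segment (ltW a0)
  (fun s h => dg s (sa s (subset_itv_oo_cc h))) (gc _ _ sa).
rewrite g0 => gE; exists s; first exact: sa.
by rewrite -/(g a) -opprB gE sub0r mulrN opprK.
Qed.

Lemma linear_approx_differentiable (V W : normedModType R) (f : V -> W)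
    (df : {linear V -> W}) (x : V) : continuous df ->
  (forall e : R, 0 < e ->
    \forall v \near (0 : V), `|f (v + x) - f x - df v| <= e * `|v|) ->
  differentiable f x.
Proof.
move=> dfc fdf.
have fE : f \o shift x = cst (f x) + df +o_ 0 id.
  apply/eqaddoP => e e0; apply: filterS (fdf e e0) => v /=.
  by rewrite !fctE /= opprD addrA.
by apply/diff_locallyP; rewrite (diff_unique dfc fE).
Qed.

Lemma near_eq_differentiable (V W : normedModType R) (f g : V -> W) (x : V) :
  (\near x, f x = g x) -> differentiable f x -> differentiable g x.
Proof.
move=> fg df; have dfc := diff_continuous df.
apply: (linear_approx_differentiable dfc) => e e0.
have /eqaddoP/(_ e e0) := diff_locally df.
have fg0 : \forall h \near (0 : V), f (h + x) = g (h + x).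
  move: fg; rewrite [X in X -> _](near_shift 0)/=.
  by apply: filterS => h /=; rewrite subr0.
apply: filterS2 fg0 => h fgh /=.
by rewrite !fctE /= opprD addrA -fgh -(nbhs_singleton fg).
Qed.

End Differentiability.

(** * Functions of class C^1 are differentiable *)

Section CkDifferentiable.
Context {R : realType} {d : nat}.
Implicit Types (U : set 'rV[R]_d) (f : 'rV[R]_d -> R).

Lemma smooth_on_partial U f i : smooth_on U f -> smooth_on U (partial i f).
Proof. by move=> fs k; have [_ /(_ i)[]] := fs k.+1. Qed.

Lemma smooth_on_derivable U f y i :
  smooth_on U f -> U y -> derivable f y (delta_mx 0 i).
Proof. by move=> fs Uy; have [_ /(_ i)[/(_ y Uy)]] := fs 1%N. Qed.

Lemma Ck_on_subset k U U' f : U' `<=` U -> Ck_on k U f -> Ck_on k U' f.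
Proof.
move=> UU'; elim: k f => [|k IHk] f /= [fc fd].
  by split => // y /UU'/fc.
split; first by move=> y /UU'/fc.
move=> i; have [fdi fk] := fd i.
by split; [move=> y /UU'/fdi|exact: IHk].
Qed.

(** The vertices of the path from 0 to v that follows the coordinate axes one
    after the other. *)
Definition truncate_row m (v : 'rV[R]_d) : 'rV[R]_d :=
  \row_(k < d) (if (k < m)%N then v 0 k else 0).

Lemma coord_le_norm (v : 'rV[R]_d) k : `|v 0 k| <= `|v|.
Proof.
rewrite [leRHS]/Num.Def.normr/= mx_normrE.
exact: (le_bigmax _ (fun ij : 'I_1 * 'I_d => `|v ij.1 ij.2|) (0, k)).
Qed.

Lemma norm_le_coord (v : 'rV[R]_d) (r : R) :
  0 <= r -> (forall k, `|v 0 k| <= r) -> `|v| <= r.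
Proof.
move=> r0 vr; rewrite [leLHS]/Num.Def.normr/= mx_normrE.
by apply: bigmax_le => // -[i k] _ /=; rewrite ord1.
Qed.

Lemma truncate_rowS (v : 'rV[R]_d) (k : 'I_d) :
  truncate_row k.+1 v = v 0 k *: delta_mx 0 k + truncate_row k v.
Proof.
apply/rowP => j; rewrite !mxE ltnS leq_eqVlt eqxx/=.
have [->|jk] := eqVneq j k; first by rewrite !eqxx ltnn mulr1 addr0.
by rewrite val_eqE (negbTE jk)/= mulr0 add0r.
Qed.

(** The norm is the maximum of the coordinates, and along the axis-parallel path
    every coordinate stays between 0 and that of v. *)
Lemma norm_truncate_line (v : 'rV[R]_d) (k : 'I_d) s :
  `|s| <= `|v 0 k| -> `|s *: delta_mx 0 k + truncate_row k v| <= `|v|.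
Proof.
move=> sv; apply: norm_le_coord => // j; rewrite !mxE eqxx/=.
have [->|jk] := eqVneq j k.
  by rewrite ltnn mulr1 addr0 (le_trans sv)// coord_le_norm.
rewrite mulr0 add0r; case: ifP => _; first exact: coord_le_norm.
by rewrite normr0.
Qed.

(** The increment of f from y to y + v is split along the axis-parallel path.
    By the mean value theorem, the part along the axis k is v_k times a value of
    the k-th partial derivative near y, which is within e / (d + 1) of the one
    at y by continuity; the d errors add up to at most e |v|. *)
Lemma Ck_on_differentiable U f y :
  open U -> Ck_on 1 U f -> U y -> differentiable f y.
Proof.
move=> Uo [_ fC] Uy.
pose c := \col_k partial k f y.
pose df0 (v : 'rV[R]_d) : R := (v *m c) 0 0.
have df_lin : linear df0.
  by move=> a u v; rewrite /df0 mulmxDl -scalemxAl !mxE.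
pose dfM := GRing.isLinear.Build _ _ _ _ _ df_lin.
pose df : {linear 'rV[R]_d -> R} := HB.pack df0 dfM.
have dfE v : df v = \sum_k v 0 k * partial k f y.
  by rewrite /df/= /df0 mxE; apply: eq_bigr => k _; rewrite !mxE.
have dfc : continuous df.
  rewrite (_ : df = (fun v => \sum_k v 0 k * partial k f y) :> (_ -> _));
    last by apply/funext => v; rewrite dfE.
  apply: continuous_big => [|k _ v]; first exact: add_continuous.
  have vk : N 0 k @[N --> v] --> v 0 k by exact: coord_continuous.
  exact: (cvgMr_tmp vk).
apply: (linear_approx_differentiable dfc) => e e0.
have d0 : 0 < d.+1%:R :> R by [].
(* d + 1 and not d, which may be 0 *)
pose e1 := e / d.+1%:R.
have e10 : 0 < e1 by rewrite divr_gt0.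
have nbr : \forall z \near y,
    U z /\ forall k, `|partial k f z - partial k f y| <= e1.
  near=> z; split; first by near: z; exact: open_nbhs_nbhs.
  near: z; apply: filter_forall => k.
  have [_ [kc _]] := fC k.
  have /cvgrPdist_le/(_ _ e10) := kc y Uy.
  by apply: filterS => z; rewrite distrC.
have [r /= r0 rP] := (nbhs_ballP _ _).1 nbr.
have step v : `|v| < r -> forall m, (m <= d)%N ->
    `|f (truncate_row m v + y) - f y
       - \sum_(k < d | (k < m)%N) v 0 k * partial k f y| <= m%:R * (e1 * `|v|).
  move=> vr; elim=> [|m IHm] md.
    rewrite mul0r big_pred0// (_ : truncate_row 0 v = 0) ?add0r ?subrr ?subr0 ?normr0//.
    by apply/rowP => k; rewrite !mxE.
  pose k := Ordinal md.
  pose x := truncate_row k v + y.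
  have near_line s : `|s| <= `|v 0 k| -> ball y r (s *: delta_mx 0 k + x).
    move=> sv; rewrite -ball_normE /= /x distrC addrA addrK.
    exact: le_lt_trans (norm_truncate_line sv) vr.
  have [s sv sE] := @directional_MVT _ _ f x (delta_mx 0 k) (v 0 k)
    (fun s sv => (fC k).1 _ (rP _ (near_line s sv)).1).
  rewrite (bigD1 k)//= (eq_bigl (fun j : 'I_d => (j < m)%N)); last first.
    by move=> j; rewrite -val_eqE /= ltnS ltn_neqAle andbC.
  rewrite (truncate_rowS v k) -(addrA (v 0 k *: _)) -/x.
  set S := \sum_(_ < d | _) _.
  have -> : f (v 0 k *: delta_mx 0 k + x) - f y - (v 0 k * partial k f y + S) =
      (f (v 0 k *: delta_mx 0 k + x) - f x - v 0 k * partial k f y)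
      + (f x - f y - S) by ring.
  rewrite -natr1 mulrDl mul1r addrC (le_trans (ler_normD _ _))// lerD ?IHm ?(ltnW md)//.
  rewrite sE -/(partial k f _) (mulrC (v 0 k)) -mulrBl normrM.
  apply: ler_pM => //; last exact: coord_le_norm.
  exact: (rP _ (near_line s sv)).2.
have : \forall v \near (0 : 'rV[R]_d), `|v| < r.
  by apply/nbhs_ballP; exists r => //= v; rewrite -ball_normE /= sub0r normrN.
apply: filterS => v vr.
have := step v vr d (leqnn d).
rewrite (_ : truncate_row d v = v); last by apply/rowP => k; rewrite !mxE ltn_ord.
rewrite (eq_bigl xpredT) => [|k]; last by rewrite ltn_ord.
rewrite -dfE => /le_trans; apply.
rewrite mulrA ler_wpM2r// /e1 mulrCA ger_pMr// ler_pdivrMr// mul1r ler_nat.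
exact: leqnSn.
Unshelve. all: by end_near. Qed.

Lemma smooth_map_on_differentiable e U (F : 'rV[R]_d -> 'rV[R]_e) y :
  open U -> smooth_map_on U F -> U y -> differentiable F y.
Proof.
move=> Uo Fs Uy.
have -> : F = \sum_i (fun z => F z 0 i *: delta_mx 0 i).
  by apply/funext => z; rewrite fct_sumE [LHS]row_sum_delta.
apply: differentiable_sum => i; apply: differentiableZl.
exact: Ck_on_differentiable Uo (Fs i 1%N) Uy.
Qed.

End CkDifferentiable.

Lemma jacobian_partial (R : realType) (d e : nat) (F : 'rV[R]_d -> 'rV[R]_e)
    (y : 'rV[R]_d) i j :
  differentiable F y -> jacobian F y i j = partial i (fun z => F z 0 j) y.
Proof.
move=> Fd; rewrite /partial.
transitivity ((delta_mx (0 : 'I_1) i *m jacobian F y) 0 j).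
  by rewrite -rowE [RHS]mxE.
by rewrite -deriveEjacobian// derive_mx ?mxE//; exact: diff_derivable.
Qed.

(** * Restriction of charts to open sets *)

Lemma open_preimage_in (S T : topologicalType) (f : S -> T) (D : set S)
    (A : set T) :
  open D -> (forall x, D x -> {for x, continuous f}) -> open A ->
  open (D `&` f @^-1` A).
Proof.
move=> Do fc Ao; rewrite openE => x [Dx Afx].
apply: filterI; first exact: open_nbhs_nbhs.
by apply: (fc x Dx); exact: open_nbhs_nbhs.
Qed.

Section ChartRestriction.
Context {R : realType} {d : nat}.

Lemma chart_imageI (T : topologicalType) (phi : chart R d T) (A : set T) :
  phi @` (cdom phi `&` A) = cimg phi `&` cinv phi @^-1` A.
Proof.
apply/seteqP; split=> [_ [x [px Ax] <-]|_ [[x px <-]]] /=.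
  by split; [exists x|rewrite /= cmapK].
by rewrite cmapK// => Ax; exists x.
Qed.

Lemma open_chart_imageI (T : topologicalType) (phi : chart R d T) (A : set T) :
  open A -> open (phi @` (cdom phi `&` A)).
Proof.
move=> Ao; rewrite chart_imageI; apply: open_preimage_in => //.
- exact: cimg_open.
- exact: cinv_continuous.
Qed.

Lemma cinv_continuous_imageI (T : topologicalType) (phi : chart R d T)
    (A : set T) y :
  (phi @` (cdom phi `&` A)) y -> {for y, continuous (cinv phi)}.
Proof. by move=> [x [phix _] <-]; apply: cinv_continuous; exists x. Qed.

(** Vector fields on an open submanifold W have components only in the charts
    whose domain is inside W; a chart of the ambient manifold has to be
    restricted before these components can be used. *)
Definition restrict_chart (T : topologicalType) (phi : chart R d T)
    (A : set T) (Ao : open A) : chart R d T :=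
  @Chart R d T (cdom phi `&` A) phi (cinv phi)
    (openI (cdom_open phi) Ao) (open_chart_imageI Ao)
    (fun x xA => cmapK xA.1) (fun x xA => cmap_continuous xA.1)
    (cinv_continuous_imageI (A := A)).

Lemma smooth_map_on_subset e (U U' : set 'rV[R]_d) (F : 'rV[R]_d -> 'rV[R]_e) :
  U' `<=` U -> smooth_map_on U F -> smooth_map_on U' F.
Proof. by move=> UU' Fs i k; apply: Ck_on_subset UU' (Fs i k). Qed.

(** By maximality of the atlas, as the transition maps of the restriction are
    those of phi on smaller domains. *)
Lemma atlas_restrict_chart (N : manifold R d) (phi : chart R d N) (A : set N)
    (Ao : open A) : atlas phi -> atlas (restrict_chart phi Ao).
Proof.
move=> aphi; apply: atlas_maximal => psi apsi.
have [phipsi psiphi] := atlas_compatible aphi apsi.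
split; [apply: smooth_map_on_subset phipsi|apply: smooth_map_on_subset psiphi];
  by apply: image_subset => x [[phix _] psix].
Qed.

Lemma transition_differentiable (N : manifold R d) (phi psi : chart R d N) x :
  atlas phi -> atlas psi -> cdom phi x -> cdom psi x ->
  differentiable (transition phi psi) (phi x).
Proof.
move=> aphi apsi phix psix.
apply: smooth_map_on_differentiable (atlas_compatible aphi apsi).1 _.
  exact/open_chart_imageI/cdom_open.
by exists x.
Qed.

End ChartRestriction.

(** * The Lie derivative along fields in the kernel *)

Section LieDerivative.
Context {R : realType} {d : nat} {N : manifold R d}.
Implicit Types (X E : vector_components N) (g : tensor2_components N).

(** The terms with a derivative of f are d_i f (X^k g_kj) and
    d_j f (X^k g_ik), and both contractions of X with g vanish. *)
Lemma lie_derivative_scale X E g phi y (f : 'rV[R]_d -> R) :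
  (forall i, derivable f y (delta_mx 0 i)) ->
  (forall i k, derivable (fun z => X phi z 0 k) y (delta_mx 0 i)) ->
  (\near y, E phi y = f y *: X phi y) ->
  X phi y *m g phi y = 0 -> (g phi y)^T = g phi y ->
  lie_derivative E g phi y = f y *: lie_derivative X g phi y.
Proof.
move=> fd Xd EfX Xg gT.
have gC i j : g phi y i j = g phi y j i by rewrite -[in LHS]gT mxE.
have XgE j : \sum_k X phi y 0 k * g phi y k j = 0.
  by have /rowP/(_ j) := Xg; rewrite !mxE.
have dE i k : partial i (fun z => E phi z 0 k) y =
    f y * partial i (fun z => X phi z 0 k) y + X phi y 0 k * partial i f y.
  rewrite /partial -[LHS](near_eq_derive (f := f * (fun z => X phi z 0 k))).
    by rewrite deriveM.
  by apply: filterS EfX => z ->; rewrite mxE.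
apply/matrixP => i j; rewrite !mxE mulr_sumr.
transitivity (\sum_k f y * (X phi y 0 k * partial k (fun z => g phi z i j) y
     + g phi y k j * partial i (fun z => X phi z 0 k) y
     + g phi y i k * partial j (fun z => X phi z 0 k) y)
   + (\sum_k X phi y 0 k * g phi y k j) * partial i f y
   + (\sum_k X phi y 0 k * g phi y k i) * partial j f y); last first.
  by rewrite !XgE !mul0r !addr0.
rewrite !mulr_suml -!big_split/=; apply: eq_bigr => k _.
rewrite !dE (nbhs_singleton EfX) mxE (gC i k); ring.
Qed.

(** Where X vanishes, g_kj d_i X^k = d_i (X^k g_kj), the derivative of 0. *)
Lemma lie_derivative_eq0 X g phi y :
  (forall i k, derivable (fun z => X phi z 0 k) y (delta_mx 0 i)) ->
  (forall l i j, derivable (fun z => g phi z i j) y (delta_mx 0 l)) ->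
  (\near y, X phi y *m g phi y = 0) -> (g phi y)^T = g phi y ->
  X phi y = 0 -> lie_derivative X g phi y = 0.
Proof.
move=> Xd gd Xg gT X0.
have gC i j : g phi y i j = g phi y j i by rewrite -[in LHS]gT mxE.
have Xk k : X phi y 0 k = 0 by rewrite X0 mxE.
have dXg i j : \sum_k g phi y k j * partial i (fun z => X phi z 0 k) y = 0.
  pose h k : 'rV[R]_d -> R := (fun z => X phi z 0 k) * (fun z => g phi z k j).
  have hd k : derivable (h k) y (delta_mx 0 i) by exact: derivableM.
  have : 'D_(delta_mx 0 i) (\sum_k h k) y = 0.
    rewrite -(derive_cst (0 : R) y (delta_mx 0 i)); apply: near_eq_derive.
    apply: filterS Xg => z /rowP/(_ j); rewrite !mxE /cst => <-.
    by rewrite fct_sumE.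
  rewrite derive_sum// => dh0; rewrite -[RHS]dh0; apply: eq_bigr => k _.
  by rewrite /h deriveM//= Xk scale0r add0r.
apply/matrixP => i j; rewrite !mxE -[RHS]addr0.
rewrite -[X in _ = X + _](dXg i j) -[X in _ = _ + X](dXg j i).
rewrite -big_split/=; apply: eq_bigr => k _.
by rewrite Xk mul0r add0r (gC i k).
Qed.

End LieDerivative.

(** * Vertical fields in the charts adapted to the line bundle *)

Section BundleCharts.
Context {R : realType} {n : nat} {M : manifold R n} {L : line_bundle M}.
Implicit Types (chi : chart R n M) (phi psi : chart R (n + 1) L).

Local Notation linear_chart chi psi :=
  (bundle_chart (@lb_proj _ _ _ L) (lb_zero L) (@lb_add _ _ _ L)
     (@lb_scale _ _ _ L) chi psi).

(** A point with t = 0 has the same coordinates as the zero of its fibre. *)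
Lemma fibre_coord_neq0 chi psi x :
  linear_chart chi psi -> cdom psi x -> principal L x ->
  rsubmx (psi x) 0 0 != 0.
Proof.
move=> [dom base _ [zero _ _]] psix; apply: contra_notN => /eqP t0.
have chix : cdom chi (lb_proj x) by move: psix; rewrite dom.
have psi0 : cdom psi (lb_zero L (lb_proj x)) by rewrite dom /= lb_proj_zero.
rewrite -[LHS](cmapK psix) -[RHS](cmapK psi0); congr (cinv psi _).
rewrite -[LHS]hsubmxK -[RHS]hsubmxK !base// lb_proj_zero zero//.
by congr row_mx; apply/rowP => i; rewrite ord1 t0 mxE.
Qed.

(** In the adapted chart the multiples of x form the line s |-> (x^a, s t), so that
    the velocity of s |-> exp(s) x is (0, t); the chain rule carries it over to the
    chart phi. *)
Lemma euler_linear_chart chi phi psi x :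
  atlas phi -> atlas psi -> linear_chart chi psi ->
  cdom phi x -> cdom psi x ->
  euler L phi (phi x) =
    row_mx 0 (rsubmx (psi x)) *m jacobian (transition psi phi) (psi x).
Proof.
move=> aphi apsi [dom base _ [_ _ scale]] phix psix.
pose w : 'rV[R]_(n + 1) := row_mx 0 (rsubmx (psi x)).
have curveE s : phi (lb_scale s x) = transition psi phi ((s - 1) *: w + psi x).
  have psis : cdom psi (lb_scale s x).
    by move: psix; rewrite dom /= lb_proj_scale.
  rewrite /transition /=; have -> : (s - 1) *: w + psi x = psi (lb_scale s x).
    rewrite -[RHS]hsubmxK base// lb_proj_scale -base// scale//.
    rewrite -[X in _ + X]hsubmxK scale_row_mx add_row_mx scaler0 add0r.
    by rewrite scalerBl scale1r subrK.
  by rewrite cmapK.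
pose q (r : R) := transition psi phi (r *: w + psi x).
pose a (s : R) : R := expR s - 1.
have -> : euler L phi (phi x) = derive1 (q \o a) 0.
  rewrite /euler cmapK//; congr (derive1 _ _); apply/funext => s /=.
  exact: curveE.
have a0 : a 0 = 0 by rewrite /a expR0 subrr.
have da : is_derive (0 : R) 1 a 1 by apply: is_derive_eq; rewrite expR0 subr0.
have u0 : 0 *: w + psi x = psi x by rewrite scale0r add0r.
have Td : differentiable (transition psi phi) (psi x).
  exact: transition_differentiable.
have dq : is_derive (0 : R) 1 q ('D_w (transition psi phi) (0 *: w + psi x)).
  by apply: is_derive_line; rewrite u0; exact: diff_derivable.
have ad : differentiable a 0 by apply/derivable1_diffP; exact: ex_derive.
have qd : differentiable q 0 by apply/derivable1_diffP; exact: ex_derive.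
have qE : 'D_1 q 0 = w *m jacobian (transition psi phi) (psi x).
  have [_ ->] := dq.
  rewrite u0.
  exact: deriveEjacobian.
rewrite derive1E deriveE; last by apply: differentiable_comp; rewrite ?a0.
rewrite diff_comp ?a0//= -(deriveE _ ad).
have [_ ->] := da.
by rewrite -(deriveE _ qd).
Qed.

(** The projection to the base is (x^a, t) |-> x^a in the adapted chart, so that
    verticality says that the first n components of X are zero there.  The last
    one is written as a function of the components of X in phi, in order to
    make its regularity in the coordinates of phi visible. *)
Lemma vertical_linear_chart (X : vector_field (principal L)) chi phi psi x :
  vertical X -> chart_on (principal L) phi ->
  atlas chi -> atlas psi -> linear_chart chi psi ->
  cdom phi x -> cdom psi x ->
  X phi (phi x) =
    row_mx 0 (rsubmx (X phi (phi x) *m jacobian (transition phi psi) (phi x)))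
      *m jacobian (transition psi phi) (psi x).
Proof.
move=> vX [aphi phiP] achi apsi [dom base _ _] phix psix.
pose psi' := restrict_chart psi (cdom_open phi).
have psi'P : chart_on (principal L) psi'.
  by split; [exact: atlas_restrict_chart|move=> z [_ /phiP]].
have psi'x : cdom psi' x by [].
have XE : X psi' (psi x) = X phi (phi x) *m jacobian (transition phi psi) (phi x).
  exact: (vf_transform X (conj aphi phiP) psi'P phix psi'x).
have chix : cdom chi (lb_proj x) by move: psix; rewrite dom.
have X0 : lsubmx (X psi' (psi x)) = 0.
  have <- := vX psi' chi psi'P achi x psi'x chix.
  have projE : \forall z \near psi x,
      lsubmx z = (chi \o @lb_proj _ _ _ L \o cinv psi) z.
    have : nbhs (psi x) (cimg psi).
      by apply: open_nbhs_nbhs; split; [exact: cimg_open|exists x].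
    by apply: filterS => _ [z psiz <-] /=; rewrite cmapK// base.
  have ld := @differentiable_lsubmx R 1 n 1 (psi x).
  rewrite -deriveEjacobian; last exact: near_eq_differentiable projE ld.
  rewrite -(near_eq_derive _ projE) deriveE// diff_lin//.
  exact: continuous_lsubmx.
rewrite -XE -[X in row_mx X]X0 hsubmxK.
exact: (vf_transform X psi'P (conj aphi phiP) psi'x phix).
Qed.

(** f is the quotient t / xi of the last components of the Euler field and of X
    in an adapted chart.  It is found on a whole neighbourhood of the point, as
    the Lie derivative along f X involves the derivatives of f. *)
Lemma euler_proportional (X : vector_field (principal L)) phi x :
  vertical X -> chart_on (principal L) phi -> cdom phi x ->
  X phi (phi x) != 0 ->
  exists f : 'rV[R]_(n + 1) -> R,
    [/\ differentiable f (phi x), f (phi x) != 0 &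
        \forall z \near phi x, euler L phi z = f z *: X phi z].
Proof.
move=> vX phiP phix X0; have [aphi phiW] := phiP.
have [chi [achi chix [psi apsi lpsi]]] := lb_trivial L (lb_proj x).
have [dom _ _ _] := lpsi.
have psix : cdom psi x by rewrite dom.
pose T := transition phi psi; pose last := rshift n (ord0 : 'I_1).
pose U := phi @` (cdom phi `&` cdom psi).
have Uo : open U by exact/open_chart_imageI/cdom_open.
have Ts : smooth_on U (fun z => T z 0 last).
  exact: (atlas_compatible aphi apsi).1.
have Ux : U (phi x) by exists x.
have Xs k : smooth_on U (fun z => X phi z 0 k).
  move=> m; apply: Ck_on_subset (vf_smooth X phiP k m).
  by apply: image_subset => z [].
pose t z := T z 0 last.
(* the last component of X in the adapted chart, in the coordinates of phi *)
pose xi := \sum_k ((fun z => X phi z 0 k) * partial k t).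
have xid : differentiable xi (phi x).
  apply: differentiable_sum => k; apply: differentiableM.
    exact: Ck_on_differentiable Uo (Xs k 1%N) Ux.
  exact: Ck_on_differentiable Uo (smooth_on_partial k Ts 1%N) Ux.
have td : differentiable t (phi x) by exact: Ck_on_differentiable Uo (Ts 1%N) Ux.
have xiE z : cdom phi z -> cdom psi z ->
    rsubmx (X phi (phi z) *m jacobian T (phi z)) 0 0 = xi (phi z).
  move=> phiz psiz; rewrite /xi fct_sumE !mxE; apply: eq_bigr => k _.
  by rewrite jacobian_partial//; exact: transition_differentiable.
have tE z : cdom phi z -> rsubmx (psi z) 0 0 = t (phi z).
  by move=> phiz; rewrite mxE /t /T /transition /= cmapK.
(* otherwise X would vanish in the adapted chart, hence in phi *)
have xi0 : xi (phi x) != 0.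
  apply: contraNneq X0 => xi0.
  rewrite (vertical_linear_chart vX phiP achi apsi lpsi phix psix).
  rewrite (_ : rsubmx _ = 0) ?row_mx0 ?mul0mx//.
  by apply/rowP => i; rewrite ord1 xiE// xi0 mxE.
have t0 : t (phi x) != 0.
  by rewrite -tE//; apply: fibre_coord_neq0 lpsi psix _; exact: phiW.
exists (fun z => t z * (xi z)^-1); split.
- by apply: differentiableM => //; exact: differentiableV.
- by rewrite mulf_neq0// invr_neq0.
have xic := differentiable_continuous xid.
have xin : \forall z \near phi x, xi z != 0.
  by apply: (xic [set r | r != 0]); apply: open_nbhs_nbhs; split => //.
have Un : \forall z \near phi x, U z by exact: open_nbhs_nbhs.
apply: filterS2 Un xin => _ [z [phiz psiz] <-] xiz.
rewrite (euler_linear_chart aphi apsi lpsi phiz psiz).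
rewrite [in RHS](vertical_linear_chart vX phiP achi apsi lpsi phiz psiz).
rewrite scalemxAl scale_row_mx scaler0; congr (row_mx _ _ *m _).
apply/rowP => i; rewrite ord1 [RHS]mxE xiE// tE//.
by rewrite divfK.
Qed.

End BundleCharts.

(** * Vertical fields are Killing *)

Theorem proposition3p4 (R : realType) (n : nat) (M : manifold R n)
    (L : line_bundle M) (g : carrollian_metric L)
    (euler_killing : killing g (euler L)) :
  forall X : vector_field (principal L), vertical X -> killing g X.
Proof.
move=> X vX phi phiP y phiy.
have Xg := (cm_kernel g X).2 vX phi phiP.
have Xd i k : derivable (fun z => X phi z 0 k) y (delta_mx 0 i).
  exact: smooth_on_derivable (vf_smooth X phiP k) phiy.
have gd l i j : derivable (fun z => g phi z i j) y (delta_mx 0 l).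
  exact: smooth_on_derivable (st_smooth g phiP i j) phiy.
have gT := st_symmetric g phiP phiy.
have [X0|X0] := eqVneq (X phi y) 0.
  apply: lie_derivative_eq0 => //.
  have : nbhs y (cimg phi) by apply: open_nbhs_nbhs; split => //; exact: cimg_open.
  by apply: filterS => z /Xg.
have [x phix yE] := phiy; rewrite -yE in X0.
have [f [fd f0 EfX]] := euler_proportional vX phiP phix X0.
rewrite yE in fd f0 EfX.
have := euler_killing phi phiP y phiy.
rewrite (@lie_derivative_scale _ _ _ X _ _ _ _ f) ?Xg//.
  by move/eqP; rewrite scaler_eq0 (negbTE f0)/= => /eqP.
by move=> i; exact: diff_derivable.
Qed.
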